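(* Let $d\ge4$ be an even integer. Then: (1) There exists a PPT quantum state $\rho$ on $\mathbb{C}^d\otimes\mathbb{C}^d$ with $\mathrm{SN}(\rho)-\mathrm{SN}(\rho^\Gamma)=\frac d2-2$. Such a $\rho$ exists within the class of $S\otimes\overline S$-invariant states, and also within the class of $S\otimes S$-invariant states. (2) There exists a quantum state $\rho$ on $\mathbb{C}^d\otimes\mathbb{C}^d$ whose partial transpose $\rho^\Gamma$ is local-unitary equivalent to $\rho$ and which satisfies $\mathrm{SN}(\rho)=\frac d2$. Such a $\rho$ exists within the class of $S\otimes\overline S$-invariant states, and also within the class of $S\otimes S$-invariant states.
   Context: $\Omega_d=\begin{pmatrix}0&I_{d/2}\\-I_{d/2}&0\end{pmatrix}$, $Sp(d)=\{S\in U(d):S^\top\Omega_dS=\Omega_d\}$. A matrix $X\in M_d(\mathbb{C})\otimes M_d(\mathbb{C})$ is $S\otimes S$-invariant (resp. $S\otimes\overline S$-invariant) if it is fixed under conjugation by $S\otimes S$ (resp. $S\otimes\overline S$) for all $S\in Sp(d)$, where $\overline S$ is the entrywise complex conjugate. A quantum state is a positive semidefinite trace-one matrix. $\rho^\Gamma=(\mathrm{id}\otimes\top)(\rho)$ is the partial transpose; $\rho$ is PPT if $\rho^\Gamma\ge0$. The Schmidt number $\mathrm{SN}(\rho)$ is the smallest $k$ such that $\rho$ is a convex combination of pure states $|\xi\rangle\langle\xi|$ with $\xi$ of Schmidt rank at most $k$. Two matrices $X,Y$ are local-unitary equivalent if $Y=(U_1\otimes U_2)X(U_1\otimes U_2)^*$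 for some $U_1,U_2\in U(d)$. *)

(* Defs.v *)
From HB Require Import structures.
From mathcomp Require Import all_boot all_order all_algebra.
From mathcomp Require Import complex mxtens.
From mathcomp Require Import reals.

Set Implicit Arguments.
Unset Strict Implicit.
Unset Printing Implicit Defensive.

Import Order.TTheory GRing.Theory Num.Theory.
Local Open Scope ring_scope.
Local Open Scope sesquilinear_scope.

(* C^d (x) C^d is 'cV_(d * d), with (i, j) encoded by mxtens_index; x *t y is
   the Kronecker product of mxtens, M ^t* the adjoint and U \is unitarymx
   means U *m U^t* = 1. In a numClosedFieldType, 0 <= x entails that x is
   real. *)

Definition Omega (C : numClosedFieldType) (d : nat) : 'M[C]_d :=
  \matrix_(i, j) (if j == (i + d./2)%N :> nat then 1
                  else if i == (j + d./2)%N :> nat then -1 else 0).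

Lemma Omega_block (C : numClosedFieldType) (n : nat) :
  Omega C (n + n) = block_mx 0 1%:M (- 1%:M) 0.
Proof.
have hn : (n + n)./2 = n by rewrite addnn doubleK.
have neq (k : 'I_n) (m : nat) : (nat_of_ord k == n + m)%N = false.
  by rewrite ltn_eqF // ltn_addr.
apply/matrixP => i j; rewrite mxE hn.
case: (split_ordP i) => i' ->; case: (split_ordP j) => j' ->.
- by rewrite block_mxEul mxE /= ![(_ + n)%N]addnC !neq.
- rewrite block_mxEur mxE /= ![(_ + n)%N]addnC eqn_add2l neq.
  by rewrite eq_sym -val_eqE; case: eqP.
- rewrite block_mxEdl !mxE /= ![(_ + n)%N]addnC eqn_add2l neq.
  by rewrite -val_eqE; case: eqP; rewrite ?oppr0.
- by rewrite block_mxEdr mxE /= ![(_ + n)%N]addnC !eqn_add2l !neq.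
Qed.

Definition symplectic (C : numClosedFieldType) (d : nat) (S : 'M[C]_d) : Prop :=
  S \is unitarymx /\ S^T *m Omega C d *m S = Omega C d.

Definition SS_invariant (C : numClosedFieldType) (d : nat)
    (X : 'M[C]_(d * d)) : Prop :=
  forall S : 'M[C]_d, symplectic S -> (S *t S) *m X *m (S *t S)^t* = X.

Definition SSbar_invariant (C : numClosedFieldType) (d : nat)
    (X : 'M[C]_(d * d)) : Prop :=
  forall S : 'M[C]_d, symplectic S ->
    (S *t map_mx Num.conj S) *m X *m (S *t map_mx Num.conj S)^t* = X.

Definition psdmx (C : numClosedFieldType) (n : nat) (A : 'M[C]_n) : Prop :=
  A^t* = A /\ forall v : 'cV[C]_n, 0 <= (v^t* *m A *m v) 0 0.

Definition quantum_state (C : numClosedFieldType) (n : nat)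
    (rho : 'M[C]_n) : Prop :=
  psdmx rho /\ \tr rho = 1.

Definition ptrans (C : numClosedFieldType) (d : nat) (X : 'M[C]_(d * d)) :
    'M[C]_(d * d) :=
  \matrix_(k, l)
    X (mxtens_index ((mxtens_unindex k).1, (mxtens_unindex l).2))
      (mxtens_index ((mxtens_unindex l).1, (mxtens_unindex k).2)).

Lemma ptrans_tens (C : numClosedFieldType) (d : nat) (A B : 'M[C]_d) :
  ptrans (A *t B) = A *t B^T.
Proof. by apply/matrixP => k l; rewrite !mxE !mxtens_indexK. Qed.

Lemma ptrans_linear (C : numClosedFieldType) (d : nat) (a : C)
    (X Y : 'M[C]_(d * d)) :
  ptrans (a *: X + Y) = a *: ptrans X + ptrans Y.
Proof. by apply/matrixP => k l; rewrite !mxE. Qed.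

Definition PPT (C : numClosedFieldType) (d : nat) (rho : 'M[C]_(d * d)) : Prop :=
  psdmx (ptrans rho).

Definition orthonormal_family (C : numClosedFieldType) (d r : nat)
    (e : 'I_r -> 'cV[C]_d) : Prop :=
  forall i j : 'I_r, ((e i)^t* *m e j) 0 0 = (i == j)%:R.

(* The Schmidt rank is the number r of nonzero coefficients in a Schmidt
   decomposition. The type of e i *t f i is 'M_(d * d, 1 * 1), convertible to
   'cV_(d * d). *)
Definition has_schmidt_rank (C : numClosedFieldType) (d : nat)
    (xi : 'cV[C]_(d * d)) (r : nat) : Prop :=
  exists (lam : 'I_r -> C) (e f : 'I_r -> 'cV[C]_d),
    [/\ forall i, 0 < lam i, orthonormal_family e, orthonormal_family f
      & xi = \sum_(i < r) lam i *: (e i *t f i : 'cV[C]_(d * d))].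

Definition schmidt_number_le (C : numClosedFieldType) (d : nat)
    (rho : 'M[C]_(d * d)) (k : nat) : Prop :=
  exists (N : nat) (p : 'I_N -> C) (xi : 'I_N -> 'cV[C]_(d * d)),
    [/\ forall i, 0 <= p i,
        \sum_(i < N) p i = 1,
        forall i, ((xi i)^t* *m xi i) 0 0 = 1,
        forall i, exists2 r, (r <= k)%N & has_schmidt_rank (xi i) r
      & rho = \sum_(i < N) p i *: (xi i *m (xi i)^t*)].

(* A relation, since the Schmidt number is only defined for states. *)
Definition has_schmidt_number (C : numClosedFieldType) (d : nat)
    (rho : 'M[C]_(d * d)) (k : nat) : Prop :=
  schmidt_number_le rho k /\
  forall j : nat, schmidt_number_le rho j -> (k <= j)%N.

Definition local_unitary_equiv (C : numClosedFieldType) (d : nat)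
    (X Y : 'M[C]_(d * d)) : Prop :=
  exists U1 U2 : 'M[C]_d,
    [/\ U1 \is unitarymx, U2 \is unitarymx
      & Y = (U1 *t U2) *m X *m (U1 *t U2)^t*].

(* Main.v *)
Require Import Defs.
From HB Require Import structures.
From mathcomp Require Import all_boot all_order all_algebra.
From mathcomp Require Import complex mxtens.
From mathcomp Require Import reals ring.

Set Implicit Arguments.
Unset Strict Implicit.
Unset Printing Implicit Defensive.

Import Order.TTheory GRing.Theory Num.Theory.
Local Open Scope ring_scope.
Local Open Scope sesquilinear_scope.

(* Let n = d/2, let F be the swap, Phi the unnormalised maximally entangled
   projector and P the projector on vec Omega. The state rho_c proportional to
   1 + F + c P is S (x) S-invariant, and its partial transpose is proportional
   to 1 + Phi + c F', where F' and P are the conjugates of F and Phi by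
   1 (x) Omega; so rho_1 is locally equivalent to its partial transpose.
   - SN(rho_c) >= n for c > 0: the range of rho_c is Sym + C Omega, and a matrix
     whose antisymmetric part is a nonzero multiple of Omega has rank >= n.
   - SN(rho_c) <= n for c <= 1: Omega + diag(x_i, - conj x_i) is a sum of n
     orthogonal product vectors, and averaging over independent phases x_i
     gives P plus a diagonal part dominated by 1 + F.
   - SN <= 2 for the partial transpose when c = 2/d: average over phases x_i and
     an index p the matrices x_i conj x_j restricted to the blocks {p} and
     its complement, and compare the result with 1 + Phi + c F'.
   - The partial transpose is not separable, since otherwise rho_c would be.
   Conjugation by 1 (x) Omega carries S (x) S-invariance to
   S (x) conj S-invariance, and commutes with the partial transpose. *)

(** * Cones spanned by projectors on vectors of bounded Schmidt rank *)

Section Cone.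
Variable C : numClosedFieldType.
Implicit Types (d k r : nat).

Definition dot m (u v : 'cV[C]_m) : C := (u^t* *m v) 0 0.

Lemma dotE m (u v : 'cV[C]_m) : dot u v = \sum_i (u i 0)^* * v i 0.
Proof. by rewrite /dot mxE; apply: eq_bigr => i _; rewrite !mxE. Qed.

Lemma dotDr m (u v w : 'cV[C]_m) : dot u (v + w) = dot u v + dot u w.
Proof. by rewrite /dot mulmxDr mxE. Qed.

Lemma dotZl m a (u v : 'cV[C]_m) : dot (a *: u) v = a^* * dot u v.
Proof.
by rewrite !dotE mulr_sumr; apply: eq_bigr => i _; rewrite mxE rmorphM mulrA.
Qed.

Lemma dotZr m a (u v : 'cV[C]_m) : dot u (a *: v) = a * dot u v.
Proof. by rewrite /dot -scalemxAr mxE. Qed.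

Lemma dotBr m (u v w : 'cV[C]_m) : dot u (v - w) = dot u v - dot u w.
Proof. by rewrite dotDr -scaleN1r dotZr mulN1r. Qed.

Lemma dotC m (u v : 'cV[C]_m) : dot v u = (dot u v)^*.
Proof.
rewrite !dotE rmorph_sum; apply: eq_bigr => i _.
by rewrite rmorphM /= conjCK mulrC.
Qed.

Lemma dot_ge0 m (u : 'cV[C]_m) : 0 <= dot u u.
Proof. by rewrite dotE sumr_ge0// => i _; rewrite mulrC mul_conjC_ge0. Qed.

Lemma dot_eq0 m (u : 'cV[C]_m) : dot u u = 0 -> u = 0.
Proof.
rewrite dotE => /eqP; rewrite psumr_eq0; last first.
  by move=> i _; rewrite mulrC mul_conjC_ge0.
move=> /allP u0; apply/matrixP => i j; rewrite ord1 mxE.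
by have := u0 i (mem_index_enum _); rewrite mulrC mul_conjC_eq0 => /eqP.
Qed.

Lemma dot_unitary m (U : 'M[C]_m) (u v : 'cV[C]_m) :
  U \is unitarymx -> dot (U *m u) (U *m v) = dot u v.
Proof.
move=> Uu; rewrite /dot trmx_mul map_mxM -mulmxA [_ *m (U *m v)]mulmxA.
by rewrite -invmx_unitary// mulVmx ?unitarymx_unit// mul1mx.
Qed.

Lemma ketE m (x : 'cV[C]_m) i j : (x *m x^t*) i j = x i 0 * (x j 0)^*.
Proof. by rewrite mxE big_ord1 !mxE. Qed.

Lemma ketZ m a (x : 'cV[C]_m) :
  (a *: x) *m (a *: x)^t* = (a * a^*) *: (x *m x^t*).
Proof. by apply/matrixP => i j; rewrite ketE [RHS]mxE ketE !mxE rmorphM mulrACA. Qed.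

Lemma tr_ket m (x : 'cV[C]_m) : \tr (x *m x^t*) = dot x x.
Proof. by rewrite mxtrace_mulC /mxtrace big_ord1. Qed.

Lemma ket_dot m (v x : 'cV[C]_m) :
  (v^t* *m (x *m x^t*) *m v) 0 0 = dot v x * (dot v x)^*.
Proof. by rewrite mulmxA -mulmxA mxE big_ord1 -/(dot v x) -/(dot x v) [dot x v]dotC. Qed.

Lemma quad_ensemble m N (p : 'I_N -> C) (xi : 'I_N -> 'cV[C]_m) v :
  dot v ((\sum_i p i *: (xi i *m (xi i)^t*)) *m v) =
  \sum_i p i * (dot v (xi i) * (dot v (xi i))^*).
Proof.
rewrite /dot mulmxA mulmx_sumr mulmx_suml summxE; apply: eq_bigr => i _.
by rewrite -scalemxAr -scalemxAl mxE -/(dot _ _) ket_dot.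
Qed.

Definition schmidt_rank_le d (xi : 'cV[C]_(d * d)) k : Prop :=
  exists2 r, (r <= k)%N & has_schmidt_rank xi r.

Lemma schmidt_rank_leW d (xi : 'cV[C]_(d * d)) k k' :
  (k <= k')%N -> schmidt_rank_le xi k -> schmidt_rank_le xi k'.
Proof. by move=> kk' [r rk xir]; exists r => //; apply: leq_trans rk kk'. Qed.

Lemma schmidt_rankZ d (xi : 'cV[C]_(d * d)) r a :
  0 < a -> has_schmidt_rank xi r -> has_schmidt_rank (a *: xi) r.
Proof.
move=> a_gt0 [lam [e [f [lam_gt0 eo fo ->]]]].
exists (fun i => a * lam i), e, f; split => // [i|]; first by rewrite mulr_gt0.
by rewrite scaler_sumr; apply: eq_bigr => i _; rewrite scalerA.
Qed.

Lemma schmidt_rank_unitary d (U V : 'M[C]_d) (xi : 'cV[C]_(d * d)) r :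
  U \is unitarymx -> V \is unitarymx ->
  has_schmidt_rank xi r -> has_schmidt_rank ((U *t V) *m xi) r.
Proof.
move=> Uu Vu [lam [e [f [lam_gt0 eo fo ->]]]].
exists lam, (fun i => U *m e i), (fun i => V *m f i); split => //.
- by move=> i j; rewrite -/(dot _ _) dot_unitary// [LHS]eo.
- by move=> i j; rewrite -/(dot _ _) dot_unitary// [LHS]fo.
rewrite mulmx_sumr; apply: eq_bigr => i _.
by rewrite -scalemxAr -[X in _ = lam i *: X](@tensmx_mul _ _ _ _ _ 1 1).
Qed.

(** An unnormalised form of [schmidt_number_le]: the weights are free, so these operators are closed
    under sums and nonnegative multiples. The vectors stay unit, so the trace is the total
    weight. *)
Definition schmidt_cone d k (X : 'M[C]_(d * d)) : Prop :=
  exists2 s : seq (C * 'cV[C]_(d * d)),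
    forall y, y \in s ->
      [/\ 0 <= y.1, dot y.2 y.2 = 1 & schmidt_rank_le y.2 k]
    & X = \sum_(y <- s) y.1 *: (y.2 *m y.2^t*).

Lemma schmidt_cone0 d k : @schmidt_cone d k 0.
Proof. by exists [::]; rewrite ?big_nil. Qed.

Lemma schmidt_coneD d k (X Y : 'M[C]_(d * d)) :
  schmidt_cone k X -> schmidt_cone k Y -> schmidt_cone k (X + Y).
Proof.
move=> [s sP ->] [t tP ->]; exists (s ++ t); last by rewrite big_cat.
by move=> y; rewrite mem_cat => /orP[/sP|/tP].
Qed.

Lemma schmidt_coneZ d k a (X : 'M[C]_(d * d)) :
  0 <= a -> schmidt_cone k X -> schmidt_cone k (a *: X).
Proof.
move=> a_ge0 [s sP ->]; exists [seq (a * y.1, y.2) | y <- s].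
  by move=> _ /mapP[y /sP[p0 n1 rk] ->]; split; rewrite ?mulr_ge0.
by rewrite big_map scaler_sumr; apply: eq_bigr => y _; rewrite scalerA.
Qed.

Lemma schmidt_cone_sum d k (I : Type) (r : seq I) (P : pred I)
    (X : I -> 'M[C]_(d * d)) :
  (forall i, P i -> schmidt_cone k (X i)) ->
  schmidt_cone k (\sum_(i <- r | P i) X i).
Proof.
move=> XP; elim/big_ind: _ => //; first exact: schmidt_cone0.
exact: schmidt_coneD.
Qed.

Lemma schmidt_coneW d k k' (X : 'M[C]_(d * d)) :
  (k <= k')%N -> schmidt_cone k X -> schmidt_cone k' X.
Proof.
move=> kk' [s sP ->]; exists s => // y /sP[p0 n1 rk]; split => //.
exact: schmidt_rank_leW rk.
Qed.

(** The squared norm of [xi] becomes the weight of the normalised vector; the zero vector gives the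
    empty combination. *)
Lemma schmidt_cone_ket d k (xi : 'cV[C]_(d * d)) :
  schmidt_rank_le xi k -> schmidt_cone k (xi *m xi^t*).
Proof.
move=> [r rk xir]; have [xi0|xi_neq0] := eqVneq (dot xi xi) 0.
  by rewrite (dot_eq0 xi0) mul0mx; apply: schmidt_cone0.
have N_gt0 : 0 < dot xi xi by rewrite lt_def xi_neq0 dot_ge0.
pose a := sqrtC (dot xi xi); have a_gt0 : 0 < a by rewrite sqrtC_gt0.
have aC : a^* = a by apply: conj_Creal; rewrite ger0_real// ltW.
have aa : a * a = dot xi xi by rewrite -expr2 sqrtCK.
have aVC : (a^-1)^* = a^-1 by rewrite fmorphV; congr (_^-1).
exists [:: (dot xi xi, a^-1 *: xi)]; last first.
  rewrite big_seq1 /= ketZ scalerA aVC -aa mulrA mulfK ?gt_eqF// mulfV ?gt_eqF//.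
  by rewrite scale1r.
move=> y; rewrite inE => /eqP -> /=; split; first exact: dot_ge0.
  by rewrite dotZl dotZr aVC mulrA -invfM aa mulVf.
by exists r => //; apply: schmidt_rankZ; rewrite ?invr_gt0.
Qed.

Lemma schmidt_cone_unitary d k (U V : 'M[C]_d) (X : 'M[C]_(d * d)) :
  U \is unitarymx -> V \is unitarymx ->
  schmidt_cone k X -> schmidt_cone k ((U *t V) *m X *m (U *t V)^t*).
Proof.
move=> Uu Vu [s sP ->]; rewrite mulmx_sumr mulmx_suml big_seq_cond.
apply: schmidt_cone_sum => y /andP[/sP[p0 n1 [r rk yr]] _].
rewrite -scalemxAr -scalemxAl; apply: schmidt_coneZ => //.
have -> : (U *t V) *m (y.2 *m y.2^t*) *m (U *t V)^t* =
    ((U *t V) *m y.2) *m ((U *t V) *m y.2)^t*.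
  by rewrite trmx_mul map_mxM !mulmxA.
apply: schmidt_cone_ket.
by exists r => //; apply: schmidt_rank_unitary.
Qed.

Lemma psd_schmidt_cone d k (X : 'M[C]_(d * d)) : schmidt_cone k X -> psdmx X.
Proof.
move=> [s sP ->]; split.
  rewrite raddf_sum map_mx_sum big_seq_cond [RHS]big_seq_cond.
  apply: eq_bigr => y /andP[/sP[p0 _ _] _].
  apply/matrixP => i j; rewrite /= !mxE !big_ord1 !mxE !rmorphM /= conjCK.
  rewrite [X in _ * X]mulrC; congr (_ * _).
  by apply: conj_Creal; rewrite ger0_real.
move=> v; rewrite mulmx_sumr mulmx_suml summxE big_seq_cond sumr_ge0//.
move=> y /andP[/sP[p0 _ _] _].
by rewrite -scalemxAr -scalemxAl mxE ket_dot mulr_ge0// mul_conjC_ge0.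
Qed.

Lemma schmidt_number_cone d k (X : 'M[C]_(d * d)) :
  \tr X = 1 -> schmidt_cone k X -> schmidt_number_le X k.
Proof.
move=> trX [s sP eX]; pose y (i : 'I_(size s)) := tnth (in_tuple s) i.
have ys i : y i \in s by apply: mem_tnth.
have eX' : X = \sum_i (y i).1 *: ((y i).2 *m (y i).2^t*).
  by rewrite eX big_tnth.
exists (size s), (fun i => (y i).1), (fun i => (y i).2); split => //.
- by move=> i; have [] := sP _ (ys i).
- rewrite -trX eX' raddf_sum; apply: eq_bigr => i _ /=.
  by rewrite mxtraceZ tr_ket; have [_ -> _] := sP _ (ys i); rewrite mulr1.
- by move=> i; have [] := sP _ (ys i).
- by move=> i; have [] := sP _ (ys i).
Qed.

(** * Vectors of the tensor product as matrices; Schmidt rank as matrix rank *)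

Definition vec d (M : 'M[C]_d) : 'cV[C]_(d * d) :=
  \col_k M (mxtens_unindex k).1 (mxtens_unindex k).2.

Lemma vecE d (M : 'M[C]_d) i j u : vec M (mxtens_index (i, j)) u = M i j.
Proof. by rewrite mxE mxtens_indexK. Qed.

Lemma ket_vecE d (M : 'M[C]_d) i j p q :
  (vec M *m (vec M)^t*) (mxtens_index (i, j)) (mxtens_index (p, q)) =
  M i j * (M p q)^*.
Proof. by rewrite ketE !vecE. Qed.

Lemma vec_tens d (e f : 'cV[C]_d) : vec (e *m f^T) = e *t f :> 'cV[C]_(d * d).
Proof.
apply/matrixP => k u; case: (mxtens_indexP k) => i j; rewrite vecE !mxE big_ord1.
rewrite !mxE mxtens_indexK /=; by congr (e _ _ * f _ _); exact/esym/ord1.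
Qed.

(** Terms with a zero factor are discarded and the other factors normalised; the products of the
    norms become the Schmidt coefficients. Explicit orthogonal decompositions thus bound the Schmidt
    rank without any singular value decomposition. *)
Lemma schmidt_rank_orthogonal d k (a b : 'I_k -> 'cV[C]_d) :
  (forall i j, i != j -> dot (a i) (a j) = 0) ->
  (forall i j, i != j -> dot (b i) (b j) = 0) ->
  schmidt_rank_le (vec (\sum_i a i *m (b i)^T)) k.
Proof.
move=> ao bo; pose A := [set i | (dot (a i) (a i) != 0) && (dot (b i) (b i) != 0)].
exists #|A|; first by rewrite -[X in (_ <= X)%N]card_ord max_card.
pose nrm (u : 'cV[C]_d) := sqrtC (dot u u).
have nrm_gt0 u : dot u u != 0 -> 0 < nrm u.
  by move=> u0; rewrite sqrtC_gt0 lt_def u0 dot_ge0.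
have nrmC u : (nrm u)^* = nrm u.
  by apply: conj_Creal; rewrite ger0_real// sqrtC_ge0 dot_ge0.
have orth (c : 'I_k -> 'cV[C]_d) :
    (forall i, i \in A -> dot (c i) (c i) != 0) ->
    (forall i j, i != j -> dot (c i) (c j) = 0) ->
    orthonormal_family (fun m : 'I_#|A| =>
       (nrm (c (enum_val m)))^-1 *: c (enum_val m)).
  move=> c0 co p q; rewrite -/(dot _ _) dotZl dotZr fmorphV /= nrmC.
  have [->|pq] := eqVneq p q.
    have cq := c0 _ (enum_valP q).
    by rewrite mulrA -invfM -expr2 sqrtCK mulVf.
  by rewrite co ?mulr0// (inj_eq enum_val_inj).
exists (fun m => nrm (a (enum_val m)) * nrm (b (enum_val m))).
exists (fun m => (nrm (a (enum_val m)))^-1 *: a (enum_val m)).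
exists (fun m => (nrm (b (enum_val m)))^-1 *: b (enum_val m)); split.
- move=> m; have := enum_valP m; rewrite inE => /andP[a0 b0].
  by rewrite mulr_gt0 ?nrm_gt0.
- by apply: orth => // i; rewrite inE => /andP[].
- by apply: orth => // i; rewrite inE => /andP[].
rewrite -(big_enum_val (fun i => nrm (a i) * nrm (b i) *:
   ((nrm (a i))^-1 *: a i *t ((nrm (b i))^-1 *: b i) : 'cV[C]_(d * d)))).
have -> : \sum_i a i *m (b i)^T = \sum_(i in A) a i *m (b i)^T.
  rewrite [RHS]big_mkcond; apply: eq_bigr => i _; rewrite inE.
  have [/dot_eq0 ->|] := eqVneq (dot (a i) (a i)) 0; first by rewrite mul0mx.
  have [/dot_eq0 ->|//] := eqVneq (dot (b i) (b i)) 0.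
  by rewrite trmx0 mulmx0.
apply/matrixP => m u; rewrite mxE !summxE; apply: eq_bigr => i.
rewrite inE => /andP[a0 b0]; rewrite -vec_tens !mxE !big_ord1 !mxE.
have na := nrm_gt0 _ a0; have nb := nrm_gt0 _ b0.
by rewrite [RHS]mulrACA !mulVKf ?gt_eqF.
Qed.

(** A sum of [r] product vectors factors the matrix through a space of dimension [r]. *)
Lemma rank_schmidt m (M : 'M[C]_m) r : has_schmidt_rank (vec M) r -> (\rank M <= r)%N.
Proof.
move=> [lam [e [f [_ _ _ Me]]]].
have -> : M = (\matrix_(i < m, k < r) (lam k * e k i 0)) *m \matrix_(k < r, j < m) f k j 0.
  apply/matrixP => i j; rewrite -(vecE M i j 0) Me summxE [RHS]mxE.
  by apply: eq_bigr => k _; rewrite -vec_tens [LHS]mxE vecE !mxE big_ord1 !mxE mulrA.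
by apply: leq_trans (mxrankM_maxl _ _) (rank_leq_col _).
Qed.

End Cone.

(** * Averaging over fourth roots of unity *)

Section Phases.
Variables (C : numClosedFieldType) (m : nat).
Local Notation phases := {ffun 'I_m -> 'Z_4}.

(** A finite group of phases turns averages into finite sums. Signs would not suffice, because the
    average of the square of a phase must vanish too. *)
Definition phase (x : phases) (i : 'I_m) : C := 'i ^+ x i.

Lemma phase_conjK x i : phase x i * (phase x i)^* = 1.
Proof. by rewrite -normCK normrX normCi !expr1n. Qed.

Lemma phase_shift x p i :
  phase (x + [ffun j => (j == p)%:R]) i = 'i ^+ (i == p) * phase x i.
Proof.
have i4 : 'i ^+ 4 = 1 :> C by rewrite (exprM _ 2 2) sqrCi sqrrN expr1n.
rewrite /phase !ffunE -exprD addnC; case: eqP => _; last by rewrite mulr0n addr0 addn0.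
by rewrite /= (expr_mod _ i4).
Qed.

(** Multiplying the coordinate [p] by ['i] permutes the phase vectors, so the sum [S] satisfies
    [S = w * S]. *)
Lemma sum_phase_homog (f : ('I_m -> C) -> C) p w :
    w != 1 ->
    (forall z z', (forall i, z' i = 'i ^+ (i == p) * z i) -> f z' = w * f z) ->
  \sum_(x : phases) f (phase x) = 0.
Proof.
move=> w1 fP; set S := \sum_x _; suff : (1 - w) * S = 0.
  by move=> /eqP; rewrite mulf_eq0 subr_eq0 eq_sym (negPf w1) => /eqP.
rewrite mulrBl mul1r /S {1}(reindex_inj (addIr [ffun j => (j == p)%:R])) /=.
rewrite mulr_sumr -sumrB big1// => x _; apply/eqP; rewrite subr_eq0; apply/eqP.
by apply: fP => i; rewrite phase_shift.
Qed.

Lemma oppr1_neq1 : -1 != 1 :> C.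
Proof. by rewrite eqNr oner_eq0. Qed.

Lemma imaginary_neq1 : 'i != 1 :> C.
Proof.
by apply: contraNneq oppr1_neq1 => i1; rewrite -(sqrCi C) i1 expr1n.
Qed.

Lemma sum_phase i : \sum_(x : phases) phase x i = 0.
Proof.
apply: (@sum_phase_homog (fun z => z i) i 'i); first exact: imaginary_neq1.
by move=> z z' ->; rewrite eqxx.
Qed.

Lemma sum_phase_conj i j : i != j -> \sum_(x : phases) phase x i * (phase x j)^* = 0.
Proof.
move=> ij; apply: (@sum_phase_homog (fun z => z i * (z j)^*) i 'i).
  exact: imaginary_neq1.
by move=> z z' zP; rewrite !zP eqxx eq_sym (negPf ij) mul1r mulrA.
Qed.

Lemma sum_phase_mul i j : \sum_(x : phases) phase x i * phase x j = 0.
Proof.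
apply: (@sum_phase_homog (fun z => z i * z j) i ('i * 'i ^+ (j == i))).
  have [_|_] := eqVneq j i; last by rewrite mulr1 imaginary_neq1.
  by rewrite -expr2 sqrCi oppr1_neq1.
by move=> z z' zP; rewrite !zP eqxx mulrACA.
Qed.

(** The monomial is constantly 1 when the indices [i, l] match [j, k] as multisets. Otherwise
    rotating one suitable coordinate multiplies it by a factor other than 1. *)
Lemma sum_phase4 i j k l :
  \sum_(x : phases) phase x i * (phase x j)^* * ((phase x k)^* * phase x l) =
  #|{: phases}|%:R * ((i == j) && (k == l) || (i == k) && (j == l))%:R.
Proof.
have [/orP H|H] := boolP (_ || _).
  rewrite mulr1 -sum1_card natr_sum; apply: eq_bigr => x _.
  case: H => /andP[/eqP -> /eqP ->].
    by rewrite phase_conjK [_^* * _]mulrC phase_conjK mulr1.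
  by rewrite mulrACA phase_conjK [_^* * _]mulrC phase_conjK mulr1.
rewrite mulr0; pose f (z : 'I_m -> C) := z i * (z j)^* * ((z k)^* * z l).
(* [w p] is the factor gained by rotating the coordinate [p]; the cases below use [p = l] or
   [p = i]. *)
pose w p : C := 'i ^+ (i == p) * ('i ^+ (j == p))^* *
                (('i ^+ (k == p))^* * 'i ^+ (l == p)).
have fP p : w p != 1 -> \sum_(x : phases) f (phase x) = 0.
  move=> w1; apply: (sum_phase_homog (p := p) (w := w p)) => // z z' zP.
  rewrite /f /w !zP ![(_ * z _)^*]rmorphM /=.
  by rewrite [X in X * _ = _]mulrACA [X in _ * X = _]mulrACA [LHS]mulrACA.
have [ij|ij] := eqVneq i j; have [ik|ik] := eqVneq i k.
- subst j k; apply: (fP l); move: H; rewrite !eqxx /= orbb => il.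
  by rewrite /w eqxx (negPf il) !rmorph1 !mul1r imaginary_neq1.
- subst j; apply: (fP l); move: H; rewrite !eqxx /= (negPf ik) orbF => kl.
  rewrite /w eqxx (negPf kl) rmorph1 mul1r.
  have [_|_] := eqVneq i l; last by rewrite !rmorph1 !mul1r imaginary_neq1.
  by rewrite conjCi mulrN -expr2 sqrCi opprK mul1r imaginary_neq1.
- subst k; apply: (fP l); move: H; rewrite !eqxx /= (negPf ij) /= => jl.
  rewrite /w eqxx (negPf jl) rmorph1 mulr1.
  have [_|_] := eqVneq i l; last by rewrite !rmorph1 !mul1r imaginary_neq1.
  by rewrite conjCi mulNr -expr2 sqrCi opprK mulr1 imaginary_neq1.
- apply: (fP i); rewrite /w eqxx [j == i]eq_sym [k == i]eq_sym.
  rewrite (negPf ij) (negPf ik) !rmorph1 mulr1 mul1r.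
  have [_|_] := eqVneq l i; last by rewrite mulr1 imaginary_neq1.
  by rewrite -expr2 sqrCi oppr1_neq1.
Qed.

End Phases.

(** * Operators of small Schmidt number *)

Section Operators.
Variable C : numClosedFieldType.
Implicit Types d : nat.

Definition swapmx d : 'M[C]_(d * d) :=
  \matrix_(k, l) (((mxtens_unindex k).1 == (mxtens_unindex l).2) &&
                  ((mxtens_unindex k).2 == (mxtens_unindex l).1))%:R.

Definition ketmx d (M : 'M[C]_d) : 'M[C]_(d * d) := vec M *m (vec M)^t*.

(** The projector on the span of the vectors e_i (x) e_i: the diagonal correction that appears in
    each of the averages below. *)
Definition diagproj d : 'M[C]_(d * d) := \sum_i ketmx (delta_mx i i).

Lemma matrix_tensP d (X Y : 'M[C]_(d * d)) :
  (forall i j p q, X (mxtens_index (i, j)) (mxtens_index (p, q)) =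
                   Y (mxtens_index (i, j)) (mxtens_index (p, q))) -> X = Y.
Proof.
move=> XY; apply/matrixP => k l.
by case: (mxtens_indexP k) => i j; case: (mxtens_indexP l).
Qed.

Lemma sum_tens d (f : 'I_(d * d) -> C) :
  \sum_k f k = \sum_i \sum_j f (mxtens_index (i, j)).
Proof.
rewrite pair_big /= [LHS](reindex (@mxtens_index d d)) /=.
  by apply: eq_bigr => -[i j].
by exists (@mxtens_unindex d d) => k _; rewrite ?mxtens_indexK ?mxtens_unindexK.
Qed.

Lemma id_tensE d (i j p q : 'I_d) :
  (1%:M : 'M[C]_(d * d)) (mxtens_index (i, j)) (mxtens_index (p, q)) =
  ((i == p) && (j == q))%:R.
Proof. by rewrite mxE (can_eq (@mxtens_indexK d d)) -pair_eqE. Qed.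

Lemma swapmxE d (i j p q : 'I_d) :
  swapmx d (mxtens_index (i, j)) (mxtens_index (p, q)) =
  ((i == q) && (j == p))%:R.
Proof. by rewrite mxE !mxtens_indexK. Qed.

Lemma ketmxE d (M : 'M[C]_d) i j p q :
  ketmx M (mxtens_index (i, j)) (mxtens_index (p, q)) = M i j * (M p q)^*.
Proof. exact: ket_vecE. Qed.

Lemma sum_pick d (p q : 'I_d) (g : 'I_d -> 'I_d -> C) :
  \sum_i \sum_j ((p == i) && (q == j))%:R * g i j = g p q.
Proof.
rewrite (bigD1 p) //= (bigD1 q) //= !eqxx mul1r.
rewrite [X in _ + X + _]big1 => [|j jq].
  rewrite big1 ?addr0// => i ip; rewrite big1// => j _.
  by rewrite eq_sym (negPf ip) mul0r.
by rewrite eq_sym (negPf jq) mul0r.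
Qed.

Lemma sum_indicator d (i : 'I_d) : \sum_p (i == p)%:R = 1 :> C.
Proof.
rewrite (bigD1 i) //= eqxx big1 ?addr0// => p.
by rewrite eq_sym => /negPf->.
Qed.

Lemma diagprojE d (i j p q : 'I_d) :
  diagproj d (mxtens_index (i, j)) (mxtens_index (p, q)) =
  [&& i == j, i == p & i == q]%:R.
Proof.
rewrite summxE (bigD1 i) //= ketmxE !mxE eqxx big1 ?addr0; last first.
  by move=> u ui; rewrite ketmxE !mxE [i == u]eq_sym (negPf ui) mul0r.
by rewrite conjC_nat -natrM mulnb eq_sym [p == i]eq_sym [q == i]eq_sym.
Qed.

(** Each ket is the image of e_i (x) e_j under 1 + F, so the sum is the square of 1 + F, which is
    twice 1 + F. *)
Lemma sum_ket_sym d :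
  \sum_i \sum_j ketmx (delta_mx i j + delta_mx j i : 'M_d) =
  2 *: (1%:M + swapmx d).
Proof.
apply: matrix_tensP => i j p q; rewrite summxE.
pose h u v : C := ((delta_mx u v + delta_mx v u : 'M[C]_d) p q)^*.
pose g u v : C := ((i == u) && (j == v))%:R * h u v.
transitivity (\sum_u \sum_v (g u v + g v u)).
  apply: eq_bigr => u _; rewrite summxE; apply: eq_bigr => v _.
  rewrite ketmxE [X in X * _]mxE mulrDl !mxE /g /h !mxE.
  by rewrite [X in _ = _ + _ * X^*]addrC.
under eq_bigr => u _ do rewrite big_split /=.
rewrite big_split /= sum_pick exchange_big sum_pick.
rewrite [RHS]mxE [X in _ * X]mxE id_tensE swapmxE mulr_natl mulr2n.
by congr (_ + _); rewrite /h !mxE rmorphD /= !conjC_nat [p == i]eq_sym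
  [q == j]eq_sym [p == j]eq_sym [q == i]eq_sym [(j == p) && _]andbC.
Qed.

Lemma ketmxZ d a (M : 'M[C]_d) : ketmx (a *: M) = (a * a^*) *: ketmx M.
Proof.
apply: matrix_tensP => i j p q; rewrite ketmxE [RHS]mxE ketmxE !mxE rmorphM.
by rewrite mulrACA.
Qed.

Lemma ketmx_double d (M : 'M[C]_d) : ketmx (M + M) = 4 *: ketmx M.
Proof. by rewrite -mulr2n -scaler_nat ketmxZ conjC_nat -natrM. Qed.

Lemma sum_ket_sym_offdiag d :
  \sum_i \sum_(j | j != i) ketmx (delta_mx i j + delta_mx j i : 'M_d) =
  2 *: (1%:M + swapmx d) - 4 *: diagproj d.
Proof.
rewrite -sum_ket_sym scaler_sumr -sumrB; apply: eq_bigr => i _.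
by rewrite [X in _ = X - _](bigD1 i) //= ketmx_double addrAC subrr add0r.
Qed.

Lemma dot_delta d (i j : 'I_d) :
  dot (delta_mx i 0 : 'cV[C]_d) (delta_mx j 0) = (i == j)%:R.
Proof.
rewrite dotE (bigD1 i) //= !mxE eqxx conjC1 mul1r andbT big1 ?addr0// => u ui.
by rewrite !mxE (negPf ui) conjC0 mul0r.
Qed.

Lemma schmidt_cone_delta d i j k : (0 < k)%N ->
  schmidt_cone k (ketmx (delta_mx i j : 'M[C]_d)).
Proof.
move=> k0; apply: (schmidt_coneW k0); apply: schmidt_cone_ket.
have := @schmidt_rank_orthogonal C d 1 (fun=> delta_mx i 0) (fun=> delta_mx j 0).
by rewrite big_ord1 trmx_delta mul_delta_mx; apply=> u v; rewrite !ord1.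
Qed.

Lemma schmidt_cone_diagproj d k : (0 < k)%N -> schmidt_cone k (diagproj d).
Proof. by move=> k0; apply: schmidt_cone_sum => i _; apply: schmidt_cone_delta. Qed.

Lemma schmidt_cone_delta_sym d (i j : 'I_d) : i != j ->
  schmidt_cone 2 (ketmx (delta_mx i j + delta_mx j i : 'M[C]_d)).
Proof.
move=> ij; apply: schmidt_cone_ket.
pose a (t : 'I_2) : 'cV[C]_d := delta_mx (if t == 0 then i else j) 0.
pose b (t : 'I_2) : 'cV[C]_d := delta_mx (if t == 0 then j else i) 0.
have -> : delta_mx i j + delta_mx j i = \sum_t a t *m (b t)^T.
  by rewrite big_ord_recl big_ord1 /a /b !trmx_delta !mul_delta_mx.
have ji : (j == i) = false by rewrite eq_sym (negPf ij).
apply: schmidt_rank_orthogonal => u v; rewrite dot_delta.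
  by case: u v => [[|[|[]]]] //= ? [[|[|[]]]] //= ?; rewrite ?(negPf ij) ?ji.
by case: u v => [[|[|[]]]] //= ? [[|[|[]]]] //= ?; rewrite ?(negPf ij) ?ji.
Qed.

(** Without the terms [i = j], the sum for 1 + F involves only vectors of Schmidt rank two. This is
    sharper than the bound for 1 + F itself and leaves room for a diagonal term. *)
Lemma schmidt_cone_symproj_offdiag d :
  schmidt_cone 2 (1%:M + swapmx d - 2 *: diagproj d).
Proof.
have -> : 1%:M + swapmx d - 2 *: diagproj d =
    2^-1 *: (2 *: (1%:M + swapmx d) - 4 *: diagproj d).
  rewrite scalerBr !scalerA mulVf ?pnatr_eq0// scale1r (natrM _ 2 2) mulrA.
  by rewrite mulVf ?pnatr_eq0// mul1r.
rewrite -sum_ket_sym_offdiag; apply: schmidt_coneZ; first by rewrite invr_ge0 ler0n.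
apply: schmidt_cone_sum => i _; apply: schmidt_cone_sum => j ji.
by apply: schmidt_cone_delta_sym; rewrite eq_sym.
Qed.

Lemma schmidt_cone_symproj d : schmidt_cone 2 (1%:M + swapmx d).
Proof.
rewrite -[X in schmidt_cone _ X](subrK (2 *: diagproj d)).
apply: schmidt_coneD; first exact: schmidt_cone_symproj_offdiag.
by apply: schmidt_coneZ; rewrite ?ler0n//; apply: schmidt_cone_diagproj.
Qed.

Definition phased_block d p (x : {ffun 'I_d -> 'Z_4}) : 'M[C]_d :=
  \matrix_(i, j) (((i == p) == (j == p))%:R * (phase C x i * (phase C x j)^*)).

Lemma schmidt_cone_phased_block d p x :
  schmidt_cone 2 (ketmx (@phased_block d p x)).
Proof.
apply: schmidt_cone_ket.
(* [t = 0] selects the block {p}, [t = 1] its complement; disjoint supports give orthogonality. *)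
pose a (t : 'I_2) : 'cV[C]_d := \col_i (((i == p) == (t == 0))%:R * phase C x i).
pose b (t : 'I_2) : 'cV[C]_d :=
  \col_i (((i == p) == (t == 0))%:R * (phase C x i)^*).
have -> : phased_block p x = \sum_t a t *m (b t)^T.
  apply/matrixP => i j; rewrite big_ord_recl big_ord1 !mxE !big_ord1 !mxE /=.
  by case: (i == p); case: (j == p);
    rewrite /= ?(mulr0, mul0r, mul1r, add0r, addr0).
have sep (u v : 'I_2) (i : 'I_d) : u != v ->
    ((i == p) == (u == 0)) && ((i == p) == (v == 0)) = false.
  by case: u v => [[|[|[]]]] //= ? [[|[|[]]]] //= ? _; case: (i == p).
apply: schmidt_rank_orthogonal => u v uv; rewrite dotE big1// => i _.
  by rewrite !mxE rmorphM /= conjC_nat mulrACA -natrM mulnb sep// mul0r.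
by rewrite !mxE rmorphM /= conjC_nat mulrACA -natrM mulnb sep// mul0r.
Qed.

(** By [sum_phase4] two kinds of entries survive. Those with [i = j] and [k = l] lie in the blocks
    for all [d] values of [p]. Those with [i = k], [j = l] and [i != j] need [i] and [j] in a common
    block, which excludes [p = i] and [p = j] and leaves [d - 2] values. *)
Lemma sum_ket_phased_block d :
  \sum_p \sum_x ketmx (@phased_block d p x) =
  #|{: {ffun 'I_d -> 'Z_4}}|%:R *:
    (d%:R *: ketmx 1%:M + (d%:R - 2) *: (1%:M - diagproj d)).
Proof.
apply: matrix_tensP => i j k l; rewrite summxE.
pose c p : C := ((i == p) == (j == p))%:R * ((k == p) == (l == p))%:R.
pose e : C := ((i == j) && (k == l) || (i == k) && (j == l))%:R.
transitivity (\sum_p c p * (#|{: {ffun 'I_d -> 'Z_4}}|%:R * e)).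
  apply: eq_bigr => p _; rewrite summxE -sum_phase4 mulr_sumr.
  apply: eq_bigr => x _; rewrite ketmxE !mxE !rmorphM /= conjC_nat conjCK.
  by rewrite mulrACA.
rewrite -mulr_suml mulrCA [RHS]mxE; congr (_ * _).
have -> : (d%:R *: ketmx 1%:M + (d%:R - 2) *: (1%:M - diagproj d) : 'M[C]__)
      (mxtens_index (i, j)) (mxtens_index (k, l)) =
    d%:R * ((i == j) && (k == l))%:R + (d%:R - 2) *
      (((i == k) && (j == l))%:R - [&& i == j, i == k & i == l]%:R).
  rewrite mxE; congr (_ + _); rewrite mxE; congr (_ * _).
    by rewrite ketmxE !mxE conjC_nat -natrM mulnb.
  by rewrite mxE id_tensE; congr (_ + _); rewrite mxE diagprojE.
rewrite /e /c; have [->|ij] := eqVneq i j; have [->|kl] := eqVneq k l => /=.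
- under eq_bigr => p _ do rewrite !eqxx mulr1.
  by rewrite sumr_const card_ord -[1 *+ d]/(d%:R) andbb subrr mulr0 addr0.
- rewrite mulr0 add0r.
  have [->|jk] := eqVneq j k; first by rewrite (negPf kl) subrr !mulr0.
  by rewrite subrr !mulr0.
- have [il|] := eqVneq i l; last by rewrite !mulr0 subrr mulr0 addr0.
  have [jl|] := eqVneq j l; last by rewrite !mulr0 subrr mulr0 addr0.
  by rewrite il jl eqxx in ij.
- have [ik|] := eqVneq i k; last by rewrite !mulr0 subrr mulr0 addr0.
  have [jl|] := eqVneq j l; last by rewrite !mulr0 subrr mulr0 addr0.
  rewrite mulr0 add0r subr0 !mulr1 -ik -jl.
  (* Writes [d - 2] as the number of [p] other than [i] and [j]. *)
  have -> : d%:R - 2 = \sum_(p < d) (1 - ((i == p)%:R + (j == p)%:R)) :> C.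
    rewrite sumrB big_split sumr_const card_ord; congr (_ - _).
    by rewrite !sum_indicator.
  apply: eq_bigr => p _; have [<-|ip] := eqVneq i p.
    by rewrite ?eqxx [j == i]eq_sym (negPf ij) mulr0 addr0 subrr.
  have [_|_] := eqVneq j p; first by rewrite mulr0 add0r subrr.
  by rewrite mulr1 addr0 subr0.
Qed.

Lemma card_phases_gt0 d : 0 < #|{: {ffun 'I_d -> 'Z_4}}|%:R :> C.
Proof. by rewrite ltr0n; apply/card_gt0P; exists 0. Qed.

Lemma schmidt_coneV d k a (X : 'M[C]_(d * d)) :
  0 < a -> schmidt_cone k (a *: X) -> schmidt_cone k X.
Proof.
move=> a0 aX; rewrite -[X]scale1r -(mulVf (lt0r_neq0 a0)) -scalerA.
by apply: schmidt_coneZ aX; rewrite invr_ge0 ltW.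
Qed.

Lemma schmidt_cone_maxent d :
  schmidt_cone 2 (d%:R *: ketmx 1%:M + (d%:R - 2) *: (1%:M - diagproj d)).
Proof.
apply: schmidt_coneV (card_phases_gt0 d) _; rewrite -sum_ket_phased_block.
by apply: schmidt_cone_sum => p _; apply: schmidt_cone_sum => x _;
  apply: schmidt_cone_phased_block.
Qed.

(** * Averaging diagonal phase perturbations of Omega *)

Section Symplectic.
Variable n : nat.
Local Notation phases := {ffun 'I_n -> 'Z_4}.

(** The choice x, - conj x on a pair of indices i, i + n turns the block of Omega there into ((x,
    1), (-1, - conj x)), which is singular since |x| = 1. *)
Definition split_phase (x : phases) (u : 'I_(n + n)) : C :=
  match split u with inl i => phase C x i | inr i => - (phase C x i)^* end.

Lemma sum_split_phase u : \sum_x split_phase x u = 0.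
Proof.
rewrite /split_phase; case: (split u) => i; first exact: sum_phase.
by rewrite sumrN -rmorph_sum sum_phase /= conjC0 oppr0.
Qed.

(** Indices in different halves produce moments of the form z_i z_j, which vanish even for i = j. *)
Lemma sum_split_phase_conj u v :
  \sum_x split_phase x u * (split_phase x v)^* = (u == v)%:R * #|{: phases}|%:R.
Proof.
rewrite /split_phase; case: (split_ordP u) => i ->; case: (split_ordP v) => j ->.
- rewrite eq_lshift; have [->|ij] := eqVneq i j.
    rewrite mul1r -sum1_card natr_sum.
    by apply: eq_bigr => x _; rewrite phase_conjK.
  by rewrite sum_phase_conj// mul0r.
- rewrite eq_lrshift mul0r.
  under eq_bigr => x _ do rewrite rmorphN /= conjCK mulrN.
  by rewrite sumrN sum_phase_mul oppr0.
- rewrite eq_rlshift mul0r.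
  under eq_bigr => x _ do rewrite mulNr -rmorphM.
  by rewrite sumrN -rmorph_sum sum_phase_mul /= conjC0 oppr0.
- rewrite eq_rshift.
  under eq_bigr => x _ do rewrite rmorphN /= conjCK mulrNN mulrC.
  have [->|ij] := eqVneq i j.
    rewrite mul1r -sum1_card natr_sum.
    by apply: eq_bigr => x _; rewrite phase_conjK.
  by rewrite sum_phase_conj// ?mul0r// eq_sym.
Qed.

Definition phased_Omega (x : phases) : 'M[C]_(n + n) :=
  \matrix_(u, v) (Omega C (n + n) u v + (u == v)%:R * split_phase x u).

Lemma Omega_split (u v : 'I_(n + n)) :
  Omega C (n + n) u v = match split u, split v with
                        | inl i, inr j => (i == j)%:R
                        | inr i, inl j => - (i == j)%:R
                        | _, _ => 0 end.
Proof.
rewrite Omega_block; case: (split_ordP u) => i ->; case: (split_ordP v) => j ->.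
- by rewrite block_mxEul mxE.
- by rewrite block_mxEur mxE.
- by rewrite block_mxEdl !mxE.
- by rewrite block_mxEdr mxE.
Qed.

(** Each singular 2 x 2 block is the product of the column (1, - conj x) and the row (x, 1).
    Different blocks have disjoint supports, so these [n] products are orthogonal. *)
Lemma schmidt_cone_phased_Omega x : schmidt_cone n (ketmx (phased_Omega x)).
Proof.
apply: schmidt_cone_ket.
pose a (i : 'I_n) : 'cV[C]_(n + n) :=
  delta_mx (lshift n i) 0 - (phase C x i)^* *: delta_mx (rshift n i) 0.
pose b (i : 'I_n) : 'cV[C]_(n + n) :=
  phase C x i *: delta_mx (lshift n i) 0 + delta_mx (rshift n i) 0.
have -> : phased_Omega x = \sum_i a i *m (b i)^T.
  apply/matrixP => u v; rewrite summxE mxE Omega_split /split_phase.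
  under eq_bigr => i _ do rewrite !mxE big_ord1 !mxE !andbT.
  have cK i : (phase C x i)^* * phase C x i = 1 by rewrite mulrC phase_conjK.
  case: (split_ordP u) => i ->; case: (split_ordP v) => j ->;
    rewrite (bigD1 i) //= big1 => [|t ti];
    rewrite ?(eq_lshift, eq_rshift, eq_lrshift, eq_rlshift) ?eqxx;
    rewrite ?[i == t]eq_sym ?(negPf ti) 1?[j == i]eq_sym /= ?mulr0n ?mulr1n;
    try by ring.
  by case: (i == j); rewrite /= ?mulr0n ?mulr1n;
    rewrite !(mulr1, mulr0, mul0r, sub0r, addr0, mulNr) ?cK ?oppr0.
have orth (z w z' w' : C) (i j : 'I_n) : i != j ->
    dot (z *: delta_mx (lshift n i) 0 + w *: delta_mx (rshift n i) 0 : 'cV_(n + n))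
     (z' *: delta_mx (lshift n j) 0 + w' *: delta_mx (rshift n j) 0) = 0.
  move=> ij; rewrite dotE big1// => u _; rewrite !mxE !andbT.
  case: (split_ordP u) => k ->;
    rewrite !(eq_lshift, eq_rshift, eq_lrshift, eq_rlshift) !(mulr0, addr0, add0r).
    have [->|_] := eqVneq k i; first by rewrite (negPf ij) !mulr0.
    by rewrite mulr0 conjC0 mul0r.
  have [->|_] := eqVneq k i; first by rewrite (negPf ij) !mulr0.
  by rewrite mulr0 conjC0 mul0r.
apply: schmidt_rank_orthogonal => i j ij; rewrite /a /b.
  by rewrite -[delta_mx (lshift n i) 0]scale1r -[delta_mx (lshift n j) 0]scale1r
    -!scaleNr orth.
by rewrite -[delta_mx (rshift n i) 0]scale1r -[delta_mx (rshift n j) 0]scale1r orth.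
Qed.

(** Average the projectors on [phased_Omega x]: the cross terms vanish by the first moments, and the
    second moments turn the diagonal part into [diagproj]. *)
Lemma schmidt_cone_Omega_diag :
  schmidt_cone n (ketmx (Omega C (n + n)) + diagproj (n + n)).
Proof.
apply: schmidt_coneV (card_phases_gt0 n) _.
have -> : #|{: phases}|%:R *: (ketmx (Omega C (n + n)) + diagproj (n + n)) =
    \sum_x ketmx (phased_Omega x).
  apply: matrix_tensP => i j k l; rewrite summxE.
  rewrite mxE [X in _ * X]mxE diagprojE ketmxE.
  pose O := Omega C (n + n).
  transitivity (\sum_x (O i j * (O k l)^* +
    (O i j * (k == l)%:R * (split_phase x k)^* +
     (i == j)%:R * (O k l)^* * split_phase x i) +
     (i == j)%:R * (k == l)%:R * (split_phase x i * (split_phase x k)^*))).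
    rewrite !big_split /= sumr_const -!mulr_sumr sum_split_phase sum_split_phase_conj.
    rewrite -rmorph_sum sum_split_phase /= conjC0 !mulr0 !addr0 mulrDr.
    rewrite mulr_natl; congr (_ + _).
    rewrite mulrA mulrC; congr (_ * _).
    rewrite -!natrM !mulnb; congr (nat_of_bool _)%:R.
    by have [<-|_] := eqVneq i k; rewrite ?(andbF, andbT).
  apply: eq_bigr => x _; rewrite ketmxE !mxE rmorphD rmorphM /= conjC_nat.
  rewrite -/O; ring.
by apply: schmidt_cone_sum => x _; apply: schmidt_cone_phased_Omega.
Qed.

End Symplectic.

End Operators.

(** * Local unitaries and partial transposition *)

Section LocalUnitary.
Variables (C : numClosedFieldType) (d : nat).
Implicit Types (X Y : 'M[C]_(d * d)) (A B U V M : 'M[C]_d).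

Lemma tens_adjoint A B : (A *t B)^t* = A^t* *t B^t*.
Proof. by rewrite trmx_tens map_mxT. Qed.

Lemma tens1 : (1%:M : 'M[C]_d) *t (1%:M : 'M[C]_d) = 1%:M.
Proof.
by apply: matrix_tensP => i j p q; rewrite tensmxE id_tensE !mxE -natrM mulnb.
Qed.

Lemma tens_unitary U V :
  U \is unitarymx -> V \is unitarymx -> (U *t V) \is unitarymx.
Proof.
move=> Uu Vu; apply/unitarymxP; rewrite tens_adjoint tensmx_mul.
by rewrite (unitarymxP Uu) (unitarymxP Vu) tens1.
Qed.

Lemma unitarymx_adjointK (m : nat) (U : 'M[C]_m) :
  U \is unitarymx -> U^t* *m U = 1%:M.
Proof. by move=> Uu; rewrite -invmx_unitary// mulVmx// unitarymx_unit. Qed.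

Lemma unitarymx_conj_tr m (S : 'M[C]_m) :
  S \is unitarymx -> map_mx Num.conj S *m S^T = 1%:M.
Proof.
move=> /unitarymxP /(congr1 (map_mx Num.conj)); rewrite map_mxM map_mx1 => <-.
by congr (_ *m _); apply/matrixP => i j; rewrite !mxE /= conjCK.
Qed.

Lemma unitarymx1 m : (1%:M : 'M[C]_m) \is unitarymx.
Proof. by apply/unitarymxP; rewrite trmx1 map_mx1 mulmx1. Qed.

(** * Local operators and the swap acting on vectorised matrices *)

Lemma vec_inj : injective (@vec C d).
Proof.
move=> A B AB; apply/matrixP => i j.
by rewrite -(vecE A i j 0) AB vecE.
Qed.

Lemma dot_vec A B : dot (vec A) (vec B) = \tr (A^t* *m B).
Proof.
rewrite dotE sum_tens exchange_big /mxtrace; apply: eq_bigr => j _ /=.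
by rewrite mxE; apply: eq_bigr => i _; rewrite !vecE 2!mxE.
Qed.

Lemma tens_vec A B M : (A *t B) *m vec M = vec (A *m M *m B^T).
Proof.
apply/matrixP => k u; case: (mxtens_indexP k) => i j {k}; rewrite vecE mxE sum_tens.
rewrite mxE exchange_big; apply: eq_bigr => q _ /=.
rewrite mxE mulr_suml; apply: eq_bigr => p _.
by rewrite tensmxE vecE [B^T _ _]mxE mulrAC.
Qed.

Lemma tens_ketmx A B M :
  (A *t B) *m ketmx M *m (A *t B)^t* = ketmx (A *m M *m B^T).
Proof. by rewrite /ketmx -tens_vec trmx_mul map_mxM !mulmxA. Qed.

Lemma swap_mulE X i j l :
  (swapmx C d *m X) (mxtens_index (i, j)) l = X (mxtens_index (j, i)) l.
Proof.
rewrite mxE sum_tens -(sum_pick j i (fun u v => X (mxtens_index (u, v)) l)).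
by apply: eq_bigr => u _; apply: eq_bigr => v _; rewrite swapmxE andbC.
Qed.

Lemma swap_vec M : swapmx C d *m vec M = vec M^T.
Proof.
apply/matrixP => k u; case: (mxtens_indexP k) => i j {k}; rewrite vecE !mxE sum_tens.
rewrite -[RHS](sum_pick j i M).
by apply: eq_bigr => p _; apply: eq_bigr => q _; rewrite swapmxE vecE andbC.
Qed.

Lemma swapmx_adjoint : (swapmx C d)^t* = swapmx C d.
Proof.
apply: matrix_tensP => i j p q; rewrite 2!mxE !swapmxE conjC_nat.
by rewrite [q == i]eq_sym [p == j]eq_sym andbC.
Qed.

Lemma dot_swap (u v : 'cV[C]_(d * d)) :
  dot u (swapmx C d *m v) = dot (swapmx C d *m u) v.
Proof. by rewrite /dot trmx_mul map_mxM swapmx_adjoint mulmxA. Qed.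

Lemma tens_swap A B : (A *t B) *m swapmx C d = swapmx C d *m (B *t A).
Proof.
apply: matrix_tensP => i j p q; rewrite swap_mulE tensmxE mxE sum_tens.
rewrite mulrC -(sum_pick q p (fun u v => A i u * B j v)).
apply: eq_bigr => u _; apply: eq_bigr => v _.
by rewrite tensmxE swapmxE mulrC [u == _]eq_sym [v == _]eq_sym.
Qed.

(** * Partial transposition *)

Lemma mxtrace_ptrans X : \tr (ptrans X) = \tr X.
Proof. by rewrite /mxtrace; apply: eq_bigr => k _; rewrite mxE !mxtens_unindexK. Qed.

Lemma ptransE X i j p q :
  ptrans X (mxtens_index (i, j)) (mxtens_index (p, q)) =
  X (mxtens_index (i, q)) (mxtens_index (p, j)).
Proof. by rewrite mxE !mxtens_indexK. Qed.

Lemma ptransK : involutive (@ptrans C d).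
Proof. by move=> X; apply: matrix_tensP => i j p q; rewrite !ptransE. Qed.

Lemma ptransD X Y : ptrans (X + Y) = ptrans X + ptrans Y.
Proof. by rewrite -[X]scale1r ptrans_linear !scale1r. Qed.

Lemma ptransZ a X : ptrans (a *: X) = a *: ptrans X.
Proof. by apply: matrix_tensP => i j p q; rewrite [RHS]mxE !ptransE mxE. Qed.

Lemma ptrans1 : ptrans (1%:M : 'M[C]_(d * d)) = 1%:M.
Proof.
by apply: matrix_tensP => i j p q; rewrite ptransE !id_tensE [j == q]eq_sym.
Qed.

Lemma ptrans_swap : ptrans (swapmx C d) = ketmx 1%:M.
Proof.
apply: matrix_tensP => i j p q; rewrite ptransE swapmxE ketmxE !mxE.
by rewrite conjC_nat -natrM mulnb [q == p]eq_sym.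
Qed.

Lemma schmidt_number_leP X k :
  schmidt_number_le X k <-> schmidt_cone k X /\ \tr X = 1.
Proof.
split=> [[N [p [xi [p0 p1 n1 rk ->]]]]|[Xk trX]]; last exact: schmidt_number_cone.
split; last first.
  rewrite raddf_sum -[RHS]p1; apply: eq_bigr => i _ /=.
  by rewrite mxtraceZ tr_ket [dot _ _]n1 mulr1.
by apply: schmidt_cone_sum => i _; apply: schmidt_coneZ => //;
  apply: schmidt_cone_ket.
Qed.

(** * Invariance under local unitaries *)

Lemma local_unitary_equiv_sym X Y :
  local_unitary_equiv X Y -> local_unitary_equiv Y X.
Proof.
move=> [U [V [Uu Vu ->]]]; exists (U^t*), (V^t*).
have Tu := tens_unitary Uu Vu.
rewrite !trmxC_unitary Uu Vu; split => //.
rewrite -tens_adjoint trmxCK !mulmxA unitarymx_adjointK// mul1mx.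
by rewrite -mulmxA unitarymx_adjointK// mulmx1.
Qed.

Lemma local_unitary_equiv_trans X Y Z :
  local_unitary_equiv X Y -> local_unitary_equiv Y Z -> local_unitary_equiv X Z.
Proof.
move=> [U [V [Uu Vu ->]]] [U' [V' [U'u V'u ->]]].
exists (U' *m U), (V' *m V); rewrite !mul_unitarymx//; split => //.
by rewrite -tensmx_mul trmx_mul map_mxM !mulmxA.
Qed.

Lemma mxtrace_local_unitary X Y : local_unitary_equiv X Y -> \tr Y = \tr X.
Proof.
move=> [U [V [Uu Vu ->]]]; rewrite mxtrace_mulC mulmxA.
by rewrite unitarymx_adjointK ?mul1mx ?tens_unitary.
Qed.

Lemma schmidt_cone_local_unitary X Y k :
  local_unitary_equiv X Y -> schmidt_cone k X -> schmidt_cone k Y.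
Proof. by move=> [U [V [Uu Vu ->]]]; apply: schmidt_cone_unitary. Qed.

Lemma schmidt_number_le_local_unitary X Y k :
  local_unitary_equiv X Y -> schmidt_number_le X k -> schmidt_number_le Y k.
Proof.
move=> XY /schmidt_number_leP[Xk trX]; apply/schmidt_number_leP.
by rewrite (mxtrace_local_unitary XY); split=> //; apply: schmidt_cone_local_unitary Xk.
Qed.

Lemma has_schmidt_number_local_unitary X Y k :
  local_unitary_equiv X Y -> has_schmidt_number X k -> has_schmidt_number Y k.
Proof.
move=> XY [Xk Xmin]; split; first exact: schmidt_number_le_local_unitary Xk.
move=> j Yj; apply: Xmin; apply: schmidt_number_le_local_unitary Yj.
exact: local_unitary_equiv_sym.
Qed.

Lemma psdmx_local_unitary X Y : local_unitary_equiv X Y -> psdmx X -> psdmx Y.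
Proof.
move=> [U [V [_ _ ->]]] [Xh Xp]; set T := U *t V; split.
  by rewrite !trmx_mul !map_mxM trmxCK Xh mulmxA.
move=> v; have := Xp (T^t* *m v).
by rewrite trmx_mul map_mxM trmxCK !mulmxA.
Qed.

Lemma quantum_state_local_unitary X Y :
  local_unitary_equiv X Y -> quantum_state X -> quantum_state Y.
Proof.
move=> XY [Xp Xt]; split; first exact: psdmx_local_unitary Xp.
by rewrite (mxtrace_local_unitary XY).
Qed.

Lemma schmidt_number_le_quantum_state X k :
  schmidt_number_le X k -> quantum_state X.
Proof. by case/schmidt_number_leP => /psd_schmidt_cone. Qed.

Lemma ket_unvec (xi : 'cV[C]_(d * d)) :
  xi = vec (\matrix_(i, j) xi (mxtens_index (i, j)) 0).
Proof.
apply/matrixP => k u; case: (mxtens_indexP k) => i j.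
by rewrite vecE mxE ord1.
Qed.

(* The partial transpose of the projector on e (x) f is the projector on
   e (x) conj f. *)
Lemma schmidt_number_le1_ptrans X :
  schmidt_number_le X 1 -> schmidt_number_le (ptrans X) 1.
Proof.
move=> /schmidt_number_leP[[s sP eX] trX]; apply/schmidt_number_leP.
rewrite mxtrace_ptrans; split => //; rewrite eX big_seq.
rewrite (big_morph (@ptrans C d) ptransD (id1 := 0)); last first.
  by rewrite -[X in ptrans X](scale0r 0) ptransZ scale0r.
apply: schmidt_cone_sum => y ys; rewrite ptransZ.
have [p0 _ [r r1 [lam [e [f [_ _ _ ->]]]]]] := sP y ys.
(* Here [r] is 0 or 1, and [r = 0] gives the zero vector. *)
apply: schmidt_coneZ => //; case: r r1 lam e f => [|[|//]] _ lam e f.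
  rewrite big_ord0 mul0mx -[X in ptrans X](scale0r 0) ptransZ scale0r.
  exact: schmidt_cone0.
rewrite big_ord1 -vec_tens; set a := e _; set b := f _; set l := lam _.
have -> : ptrans (l *: vec (a *m b^T) *m (l *: vec (a *m b^T))^t*) =
    (l * l^*) *: ketmx (a *m (map_mx Num.conj b)^T).
  rewrite ketZ ptransZ; congr (_ *: _); apply: matrix_tensP => i j p q.
  rewrite ptransE ketE ketmxE !vecE !mxE !big_ord1 !mxE !rmorphM /= conjCK.
  by ring.
apply: schmidt_coneZ; first exact: mul_conjC_ge0.
apply: schmidt_cone_ket.
have := @schmidt_rank_orthogonal C d 1 (fun=> a) (fun=> map_mx Num.conj b).
by rewrite big_ord1; apply=> u v; rewrite !ord1.
Qed.

End LocalUnitary.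

(** * The symplectic states *)

Section SymplecticStates.
Variables (C : numClosedFieldType) (n : nat).
Local Notation d := (n + n)%N.
Local Notation Omega := (Omega C d).
Implicit Types (X Y : 'M[C]_(d * d)).

Lemma trmx_Omega : Omega^T = - Omega.
Proof.
rewrite Omega_block tr_block_mx opp_block_mx !trmx0 oppr0 opprK.
by rewrite raddfN /= trmx1.
Qed.

Lemma Omega_sqr : Omega *m Omega = - 1%:M.
Proof.
rewrite Omega_block mulmx_block !mulmx0 !mul0mx !mulmxN !mulmx1 !addr0 !add0r.
by rewrite [in RHS]scalar_mx_block opp_block_mx oppr0.
Qed.

Lemma conj_Omega : map_mx Num.conj Omega = Omega.
Proof.
by rewrite Omega_block map_block_mx !map_mx0 map_mxN !map_mx1.
Qed.

Lemma Omega_adjoint : Omega^t* = - Omega.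
Proof. by rewrite trmx_Omega map_mxN conj_Omega. Qed.

Lemma Omega_unitary : Omega \is unitarymx.
Proof. by apply/unitarymxP; rewrite Omega_adjoint mulmxN Omega_sqr opprK. Qed.

(** Multiply the defining relation on the left by conj S, the inverse of [S^T]. Thus Omega
    intertwines S with conj S, which links the two notions of invariance. *)
Lemma symplectic_conj (S : 'M[C]_d) :
  symplectic S -> map_mx Num.conj S *m Omega = Omega *m S.
Proof.
move=> [Su SO]; rewrite -[in LHS]SO !mulmxA.
by rewrite unitarymx_conj_tr// mul1mx.
Qed.

(** In tensor form: S (x) S fixes [vec Omega]. *)
Lemma symplectic_Omega (S : 'M[C]_d) : symplectic S -> S *m Omega *m S^T = Omega.
Proof.
move=> Ss; have [Su _] := Ss.
have SO : S *m Omega = Omega *m map_mx Num.conj S.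
  (* Placing Omega on both sides of the intertwining relation and using that its square is -1
     exchanges S and conj S. *)
  have := congr1 (fun A => Omega *m (A *m Omega)) (symplectic_conj Ss).
  rewrite -[_ *m Omega *m Omega]mulmxA Omega_sqr mulmxN mulmx1 mulmxN.
  rewrite -[Omega *m S *m Omega]mulmxA [Omega *m (Omega *m _)]mulmxA Omega_sqr.
  by rewrite mulNmx mul1mx => /oppr_inj.
by rewrite SO -mulmxA unitarymx_conj_tr// mulmx1.
Qed.

(** * The invariant operators, their twists and their partial transposes *)

Definition symplectic_mix (c : C) : 'M[C]_(d * d) :=
  1%:M + swapmx C d + c *: ketmx Omega.

Definition twist X : 'M[C]_(d * d) :=
  (1%:M *t Omega) *m X *m (1%:M *t Omega)^t*.

Lemma symplectic_mix_invariant c : SS_invariant (symplectic_mix c).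
Proof.
move=> S Ss; have [Su _] := Ss.
rewrite !mulmxDr !mulmxDl mulmx1 (unitarymxP (tens_unitary Su Su)).
rewrite tens_swap -[swapmx _ _ *m _ *m _]mulmxA (unitarymxP (tens_unitary Su Su)).
rewrite mulmx1.
by rewrite -scalemxAr -scalemxAl tens_ketmx symplectic_Omega.
Qed.

Lemma SS_invariantZ a X : SS_invariant X -> SS_invariant (a *: X).
Proof. by move=> XS S /XS; rewrite -scalemxAr -scalemxAl => ->. Qed.

Lemma twist_equiv X : local_unitary_equiv X (twist X).
Proof. by exists 1%:M, Omega; rewrite unitarymx1 Omega_unitary. Qed.

Lemma twist_invariant X : SS_invariant X -> SSbar_invariant (twist X).
Proof.
move=> XS S Ss; rewrite /twist.
have ST : (S *t map_mx Num.conj S) *m (1%:M *t Omega) =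
    (1%:M *t Omega) *m (S *t S).
  by rewrite !tensmx_mul mulmx1 mul1mx symplectic_conj.
set W := S *t _ in ST *; set T := 1%:M *t _ in ST *.
transitivity ((W *m T) *m X *m (W *m T)^t*).
  by rewrite trmx_mul map_mxM !mulmxA.
by rewrite ST -{2}(XS S Ss) trmx_mul map_mxM !mulmxA.
Qed.

Lemma twistE X i j p q :
  twist X (mxtens_index (i, j)) (mxtens_index (p, q)) =
  \sum_u \sum_v Omega j u * X (mxtens_index (i, u)) (mxtens_index (p, v)) * Omega q v.
Proof.
have OR u v : (Omega u v)^* = Omega u v by rewrite -{2}conj_Omega [RHS]mxE.
have row k l : ((1%:M *t Omega) *m X) (mxtens_index (k, l)) =1
    fun t => \sum_u Omega l u * X (mxtens_index (k, u)) t.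
  move=> t; rewrite mxE sum_tens (bigD1 k) //= [X in _ + X]big1 ?addr0.
    by apply: eq_bigr => u _; rewrite tensmxE mxE eqxx mul1r.
  move=> s sk; rewrite big1// => u _.
  by rewrite tensmxE mxE eq_sym (negPf sk) !mul0r.
have adj u v : Omega^t* u v = Omega v u by rewrite [LHS]mxE [X in X^*]mxE OR.
rewrite /twist tens_adjoint trmx1 map_mx1 mxE sum_tens (bigD1 p) //=.
rewrite [X in _ + X]big1 ?addr0.
  rewrite exchange_big; apply: eq_bigr => v _; rewrite row mulr_suml.
  by apply: eq_bigr => u _; rewrite tensmxE [1%:M _ _]mxE eqxx mul1r adj.
move=> s sp; rewrite big1// => u _.
by rewrite tensmxE [1%:M _ _]mxE (negPf sp) mul0r mulr0.
Qed.

(** Partial transposition turns conjugation by 1 (x) B into conjugation by 1 (x) conj B, and Omega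
    is real. *)
Lemma ptrans_twist X : ptrans (twist X) = twist (ptrans X).
Proof.
apply: matrix_tensP => i j p q; rewrite ptransE !twistE exchange_big.
apply: eq_bigr => u _; apply: eq_bigr => v _; rewrite ptransE.
by ring.
Qed.

(** P is the twist of Phi, which is the partial transpose of F. At the level of entries, the signs
    from the antisymmetry of Omega cancel. *)
Lemma ptrans_ket_Omega : ptrans (ketmx Omega) = twist (swapmx C d).
Proof.
rewrite /twist tens_swap tens_adjoint -mulmxA tensmx_mul trmx1 map_mx1 mul1mx mulmx1.
apply: matrix_tensP => i j p q; rewrite ptransE ketmxE swap_mulE tensmxE.
have OT u v : Omega v u = - Omega u v.
  by have := congr1 (fun M : 'M_d => M u v) trmx_Omega; rewrite mxE [in RHS]mxE.
have -> : (Omega p j)^* = Omega p j by rewrite -{2}conj_Omega [RHS]mxE.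
by rewrite Omega_adjoint [(- Omega) _ _]mxE -OT (OT q i) (OT j p) mulrNN mulrC.
Qed.

Lemma ptrans_symplectic_mix c :
  ptrans (symplectic_mix c) = 1%:M + ketmx 1%:M + c *: twist (swapmx C d).
Proof. by rewrite !ptransD ptransZ ptrans1 ptrans_swap ptrans_ket_Omega. Qed.

Lemma twist1 : twist 1%:M = 1%:M.
Proof.
by rewrite /twist mulmx1 (unitarymxP (tens_unitary (unitarymx1 _ _) Omega_unitary)).
Qed.

Lemma twistD X Y : twist (X + Y) = twist X + twist Y.
Proof. by rewrite /twist mulmxDr mulmxDl. Qed.

Lemma twistZ a X : twist (a *: X) = a *: twist X.
Proof. by rewrite /twist -scalemxAr -scalemxAl. Qed.

Lemma twist_ket1 : twist (ketmx 1%:M) = ketmx Omega.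
Proof.
rewrite /twist tens_ketmx !mul1mx trmx_Omega -scaleN1r ketmxZ.
by rewrite rmorphN /= conjC1 mulrNN mulr1 scale1r.
Qed.

(** Twisting twice is conjugation by 1 (x) Omega^2 = -1. *)
Lemma twist_swapK : twist (twist (swapmx C d)) = swapmx C d.
Proof.
have E : twist (swapmx C d) = swapmx C d *m (Omega *t Omega^t*).
  rewrite /twist tens_swap tens_adjoint -mulmxA tensmx_mul trmx1 map_mx1.
  by rewrite mul1mx mulmx1.
rewrite E /twist mulmxA tens_swap -!mulmxA tens_adjoint !tensmx_mul trmx1 map_mx1.
rewrite !mulmx1 mul1mx Omega_adjoint mulmxN mulNmx opprK Omega_sqr.
have -> : (- 1%:M : 'M[C]_d) *t (- 1%:M : 'M[C]_d) = 1%:M; last by rewrite mulmx1.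
by apply: matrix_tensP => i j p q; rewrite tensmxE id_tensE !mxE mulrNN -natrM mulnb.
Qed.

(** * Bounds on the Schmidt numbers of the mixtures *)

Lemma rank_Omega : \rank Omega = d.
Proof. by apply: mxrank_unit; rewrite unitarymx_unit// Omega_unitary. Qed.

Lemma dot_Omega : dot (vec Omega) (vec Omega) = d%:R.
Proof. by rewrite dot_vec unitarymx_adjointK ?Omega_unitary// mxtrace1. Qed.

Lemma mxtrace_symplectic_mix c :
  \tr (symplectic_mix c) = (d * d + d)%:R + c * d%:R.
Proof.
rewrite !mxtraceD mxtraceZ mxtrace1 tr_ket dot_Omega (natrD _ (d * d)%N d); congr (_ + _ + _).
rewrite /mxtrace sum_tens; under eq_bigr => i _ do under eq_bigr => j _ do
  rewrite swapmxE [j == i]eq_sym andbb.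
by under eq_bigr => i _ do rewrite sum_indicator; rewrite sumr_const card_ord.
Qed.

Lemma symplectic_mix_mul c (x : 'cV[C]_(d * d)) :
  symplectic_mix c *m x = x + swapmx C d *m x + (c * dot (vec Omega) x) *: vec Omega.
Proof.
rewrite !mulmxDl mul1mx -scalemxAl -mulmxA [_^t* *m x]mx11_scalar.
by rewrite mul_mx_scalar scalerA.
Qed.

Lemma swap_Omega : swapmx C d *m vec Omega = - vec Omega.
Proof.
rewrite swap_vec trmx_Omega.
by apply/matrixP => k u; rewrite !mxE.
Qed.

(* Off the line C Omega the range is symmetric, so a component xi seeing Omega
   has xi - swap xi a nonzero multiple of Omega. As a matrix identity
   M - M^T = tau Omega, this forces 2 rank M >= 2 n. *)
Lemma schmidt_number_symplectic_mix_ge a c k : (0 < n)%N -> 0 < a -> 0 < c ->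
  schmidt_number_le (a *: symplectic_mix c) k -> (n <= k)%N.
Proof.
move=> n_gt0 a_gt0 c_gt0 [N [p [xi [p0 _ _ rk eX]]]].
set w := vec Omega; set F := swapmx C d.
have N_gt0 : 0 < dot w w by rewrite dot_Omega ltr0n addn_gt0 n_gt0.
have Fw : F *m w = - w by exact: swap_Omega.
have FF (u : 'cV_(d * d)) : F *m (F *m u) = u by rewrite [u]ket_unvec !swap_vec trmxK.
have mixE v : a *: symplectic_mix c *m v =
    a *: (v + F *m v + (c * dot w v) *: w).
  by rewrite -scalemxAl symplectic_mix_mul.
(* If every component were orthogonal to [w], the quadratic form at [w] would vanish, but it equals
   [a * c * dot w w ^+ 2]. *)
have [i pi_neq0] : exists i, p i * (dot w (xi i) * (dot w (xi i))^*) != 0.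
  apply/existsP; apply: contraT; rewrite negb_exists => /forallP z.
  have : dot w (a *: symplectic_mix c *m w) = 0.
    rewrite eX quad_ensemble big1// => i _; apply/eqP.
    by have := z i; rewrite negbK.
  rewrite mixE Fw subrr add0r scalerA dotZr => /eqP.
  by rewrite !mulf_eq0 !gt_eqF.
have [p_neq0 wxi] : p i != 0 /\ dot w (xi i) != 0.
  by move: pi_neq0; rewrite !mulf_eq0 !negb_or => /and3P[-> ->].
have [M xiM] : exists M, xi i = vec M by eexists; exact: ket_unvec.
(* [m] is twice the antisymmetric part of [xi i], and [v] is the component of [m] orthogonal to
   [w]. *)
pose m := xi i - F *m xi i; pose tau := dot w m / dot w w.
pose v := m - tau *: w.
have Fm : F *m m = - m by rewrite /m mulmxBr FF opprB.
have Fv : F *m v = - v.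
  by rewrite /v mulmxBr -scalemxAr Fm Fw scalerN opprK [RHS]opprB addrC.
have wv : dot w v = 0 by rewrite dotBr dotZr divfK ?gt_eqF// subrr.
(* The mixture kills [v], which is antisymmetric and orthogonal to [w]. Its quadratic form at [v] is
   a sum of nonnegative terms, so each of them vanishes. *)
have vxi : dot v (xi i) = 0.
  have : dot v (a *: symplectic_mix c *m v) = 0.
    by rewrite mixE Fv subrr wv mulr0 scale0r addr0 scaler0 -(scale0r 0) dotZr mul0r.
  rewrite eX quad_ensemble => /psumr_eq0P z.
  have /eqP : p i * (dot v (xi i) * (dot v (xi i))^*) = 0.
    by apply: z => // j _; rewrite mulr_ge0// mul_conjC_ge0.
  by rewrite mulf_eq0 (negPf p_neq0) mul_conjC_eq0 => /eqP.
(* Since [v] is antisymmetric and orthogonal to [w], [dot v v = dot v m = 2 * dot v (xi i)]. *)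
have v0 : v = 0.
  apply: dot_eq0; rewrite {2}/v dotBr dotZr [dot v w]dotC wv conjC0 mulr0 subr0.
  rewrite dotBr vxi dot_swap Fv sub0r -scaleN1r dotZl rmorphN /= conjC1.
  by rewrite vxi mulr0 oppr0.
have mtau : m = tau *: w by apply/eqP; rewrite -subr_eq0 -/v v0.
(* By antisymmetry of [w], [dot w m = 2 * dot w (xi i)]. *)
have tau_neq0 : tau != 0.
  rewrite mulf_neq0 ?invr_eq0 ?(gt_eqF N_gt0)// dotBr dot_swap Fw -scaleN1r dotZl.
  by rewrite rmorphN /= conjC1 mulN1r opprK -mulr2n mulrn_eq0.
have MT : M - M^T = tau *: Omega.
  apply: vec_inj; move: mtau; rewrite /m xiM swap_vec => E.
  apply/matrixP => s t; have := congr1 (fun A : 'cV_(d * d) => A s t) E.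
  by rewrite !mxE.
have [r rk' xir] := rk i; rewrite xiM in xir; have Mr := rank_schmidt xir.
have dM : \rank (M - M^T) = d by rewrite MT mxrank_scale_nz// rank_Omega.
have := mxrank_add M (- M^T); rewrite dM mxrank_opp mxrank_tr => dr.
rewrite -leq_double -!addnn; apply: leq_trans dr _.
by rewrite leq_add// (leq_trans Mr).
Qed.

(** P needs one copy of [diagproj] to enter the cone, and the fraction [c] of 1 + F contains two.
    The bound [c <= 1] keeps the remaining multiple of 1 + F nonnegative, and [1 < n] admits its
    rank-two vectors. *)
Lemma schmidt_cone_symplectic_mix c : (1 < n)%N -> 0 <= c -> c <= 1 ->
  schmidt_cone n (symplectic_mix c).
Proof.
move=> n_gt1 c_ge0 c_le1.
have -> : symplectic_mix c = c *: (ketmx Omega + diagproj C d +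
    (1%:M + swapmx C d - 2 *: diagproj C d) + diagproj C d) +
    (1 - c) *: (1%:M + swapmx C d).
  apply: matrix_tensP => i j p q; rewrite !mxE.
  by ring.
have n_gt0 := ltnW n_gt1.
apply: schmidt_coneD; last first.
  apply: schmidt_coneZ; first by rewrite subr_ge0.
  exact: schmidt_coneW (schmidt_cone_symproj _ _).
apply: schmidt_coneZ => //; apply: schmidt_coneD; last exact: schmidt_cone_diagproj.
apply: schmidt_coneD; first exact: schmidt_cone_Omega_diag.
exact: schmidt_coneW (schmidt_cone_symproj_offdiag _ _).
Qed.

Lemma schmidt_cone_ptrans_symplectic_mix : (0 < n)%N ->
  schmidt_cone 2 (ptrans (symplectic_mix (2 / d%:R))).
Proof.
move=> n_gt0; have d_gt0 : 0 < d%:R :> C by rewrite ltr0n addn_gt0 n_gt0.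
have d_neq0 := lt0r_neq0 d_gt0.
apply: schmidt_coneV d_gt0 _; rewrite ptrans_symplectic_mix.
(* After scaling by [d], the value [c = 2 / d] gives F' the coefficient 2, so F' is absorbed by
   twice the twist of 1 + F. The remaining [d - 2] copies of the identity split into the
   off-diagonal part required by [schmidt_cone_maxent] and a multiple of [diagproj]. *)
have -> : d%:R *: (1%:M + ketmx 1%:M + (2 / d%:R) *: twist (swapmx C d)) =
    d%:R *: ketmx 1%:M + (d%:R - 2) *: (1%:M - diagproj C d) +
    2 *: twist (1%:M + swapmx C d) + (d%:R - 2) *: diagproj C d.
  rewrite twistD twist1 2!scalerDr scalerA mulrC (divfK d_neq0).
  set F := twist _; apply: matrix_tensP => i j p q; rewrite !mxE.
  by ring.
apply: schmidt_coneD; last first.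
  apply: schmidt_coneZ; last exact: schmidt_cone_diagproj.
  by rewrite subr_ge0 ler_nat (leq_add n_gt0 n_gt0).
apply: schmidt_coneD; first exact: schmidt_cone_maxent.
apply: schmidt_coneZ; first exact: ler0n.
exact: schmidt_cone_local_unitary (twist_equiv _) (schmidt_cone_symproj _ _).
Qed.

(** * The normalised states and their exact Schmidt numbers *)

Definition symplectic_state (c : C) : 'M[C]_(d * d) :=
  ((d * d + d)%:R + c * d%:R)^-1 *: symplectic_mix c.

Section State.
Hypothesis n_gt1 : (1 < n)%N.
Variable c : C.
Hypotheses (c_gt0 : 0 < c) (c_le1 : c <= 1).

Let nrm_gt0 : 0 < ((d * d + d)%:R + c * d%:R)^-1.
Proof.
have d_gt0 : (0 < d)%N by rewrite addn_gt0 (ltnW n_gt1).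
by rewrite invr_gt0 addr_gt0 ?mulr_gt0// ltr0n// addn_gt0 d_gt0 orbT.
Qed.

Lemma mxtrace_symplectic_state : \tr (symplectic_state c) = 1.
Proof.
rewrite mxtraceZ mxtrace_symplectic_mix mulVf//.
by have := nrm_gt0; rewrite invr_gt0 => /lt0r_neq0.
Qed.

Lemma symplectic_state_schmidt_number : has_schmidt_number (symplectic_state c) n.
Proof.
split.
  apply/schmidt_number_leP; rewrite mxtrace_symplectic_state; split => //.
  apply: schmidt_coneZ; first exact: ltW.
  by apply: schmidt_cone_symplectic_mix => //; apply: ltW.
by move=> k; apply: schmidt_number_symplectic_mix_ge nrm_gt0 c_gt0; apply: ltnW.
Qed.

Lemma symplectic_state_quantum : quantum_state (symplectic_state c).
Proof.
by have [/schmidt_number_le_quantum_state] := symplectic_state_schmidt_number.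
Qed.

Lemma symplectic_state_invariant : SS_invariant (symplectic_state c).
Proof. exact/SS_invariantZ/symplectic_mix_invariant. Qed.

(** Separability survives partial transposition, so a separable partial transpose would make the
    state itself separable, against the lower bound [n >= 2]. *)
Lemma ptrans_symplectic_state_ge2 k :
  schmidt_number_le (ptrans (symplectic_state c)) k -> (2 <= k)%N.
Proof.
move=> /schmidt_number_leP[Xk trX]; rewrite ltnNge; apply/negP => k1.
have /schmidt_number_le1_ptrans : schmidt_number_le (ptrans (symplectic_state c)) 1.
  by apply/schmidt_number_leP; split => //; apply: schmidt_coneW Xk.
rewrite ptransK => /(schmidt_number_symplectic_mix_ge (ltnW n_gt1) nrm_gt0 c_gt0).
by rewrite leqNgt n_gt1.
Qed.

End State.

Lemma ptrans_symplectic_state_schmidt_number : (1 < n)%N ->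
  has_schmidt_number (ptrans (symplectic_state (2 / d%:R))) 2.
Proof.
move=> n_gt1; have n_gt0 := ltnW n_gt1.
have d_gt0 : 0 < d%:R :> C by rewrite ltr0n addn_gt0 n_gt0.
have c_gt0 : 0 < 2 / d%:R :> C by rewrite divr_gt0 ?d_gt0 ?ltr0n.
split; last exact: ptrans_symplectic_state_ge2.
apply/schmidt_number_leP; rewrite mxtrace_ptrans mxtrace_symplectic_state//.
split => //; rewrite ptransZ; apply: schmidt_coneZ.
  by rewrite invr_ge0 addr_ge0 ?ler0n// mulr_ge0 ?ltW.
exact: schmidt_cone_ptrans_symplectic_mix.
Qed.

(** The twist sends Phi to P and F' to F, so at [c = 1] it maps 1 + Phi + F' to 1 + F + P. *)
Lemma ptrans_symplectic_state_equiv :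
  local_unitary_equiv (ptrans (symplectic_state 1)) (symplectic_state 1).
Proof.
suff E : symplectic_state 1 = twist (ptrans (symplectic_state 1)).
  by rewrite {2}E; apply: twist_equiv.
rewrite ptransZ twistZ ptrans_symplectic_mix !twistD twist1 twistZ twist_ket1.
by rewrite twist_swapK /symplectic_state /symplectic_mix !scale1r addrAC.
Qed.

End SymplecticStates.

Theorem corollary4p5 (R : realType) (d : nat) (d_ge4 : (4 <= d)%N)
    (d_even : ~~ odd d) :
  let part1 (rho : 'M[R[i]]_(d * d)) : Prop :=
    [/\ quantum_state rho, PPT rho
      & exists m n : nat,
          [/\ has_schmidt_number rho m, has_schmidt_number (ptrans rho) n
            & m%:Z - n%:Z = (d./2)%:Z - 2%:Z]] in
  let part2 (rho : 'M[R[i]]_(d * d)) : Prop :=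
    [/\ quantum_state rho, local_unitary_equiv (ptrans rho) rho
      & has_schmidt_number rho d./2] in
  ((exists rho, SSbar_invariant rho /\ part1 rho) /\
   (exists rho, SS_invariant rho /\ part1 rho)) /\
  ((exists rho, SSbar_invariant rho /\ part2 rho) /\
   (exists rho, SS_invariant rho /\ part2 rho)).
Proof.
have [n dn] : exists n, d = (n + n)%N.
  by exists d./2; rewrite addnn even_halfK.
subst d => part1 part2.
have dK : (n + n)./2 = n by rewrite addnn doubleK.
have n_gt1 : (1 < n)%N by rewrite -leq_double -[n.*2]addnn.
have d_gt0 : 0 < (n + n)%:R :> R[i] by rewrite ltr0n addn_gt0 (ltnW n_gt1).
pose c : R[i] := 2 / (n + n)%:R.
have c_gt0 : 0 < c by rewrite divr_gt0 ?d_gt0 ?ltr0n.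
have c_le1 : c <= 1.
  by rewrite ler_pdivrMr// mul1r ler_nat (leq_trans _ d_ge4).
have part1S : part1 (symplectic_state n c).
  have SNG := ptrans_symplectic_state_schmidt_number R[i] n_gt1.
  split; first exact: symplectic_state_quantum.
    (* Positivity of the partial transpose is read off its own decomposition into pure states. *)
    by have [/schmidt_number_le_quantum_state[]] := SNG.
  exists n, 2%N; split => //; last by rewrite dK.
  exact: symplectic_state_schmidt_number.
have part2S : part2 (symplectic_state n 1).
  split; first exact: symplectic_state_quantum.
    exact: ptrans_symplectic_state_equiv.
  by rewrite dK; apply: symplectic_state_schmidt_number.
split; split.
- exists (twist (symplectic_state n c)); split.
    exact/twist_invariant/symplectic_state_invariant.
  have [Q P [m [k [SN SNG mk]]]] := part1S; split.
  + exact: quantum_state_local_unitary (twist_equiv _) Q.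
  + by rewrite /PPT ptrans_twist; apply: psdmx_local_unitary (twist_equiv _) P.
  exists m, k; split => //; first exact: has_schmidt_number_local_unitary (twist_equiv _) SN.
  by rewrite ptrans_twist; apply: has_schmidt_number_local_unitary (twist_equiv _) SNG.
- by exists (symplectic_state n c); split => //; apply: symplectic_state_invariant.
- exists (twist (symplectic_state n 1)); split.
    exact/twist_invariant/symplectic_state_invariant.
  have [Q E SN] := part2S; split.
  + exact: quantum_state_local_unitary (twist_equiv _) Q.
  (* The chain of equivalences runs from the twist of the partial transpose, through the partial
     transpose and the state, to the twisted state. *)
  + rewrite ptrans_twist; apply: local_unitary_equiv_trans (twist_equiv _).
    exact: local_unitary_equiv_trans (local_unitary_equiv_sym (twist_equiv _)) E.
  exact: has_schmidt_number_local_unitary (twist_equiv _) SN.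
- by exists (symplectic_state n 1); split => //; apply: symplectic_state_invariant.
Qed.
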